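(* Let $\Omega\subset\mathbb{R}^2$ be a smooth bounded domain or a convex polygon, $V=H^1_0(\Omega)$ and $Q=H^{-1}(\Omega)$. There exist positive constants $c,C$ such that for all $(v,\xi)\in V\times Q$ there exists $w\in V$ with $$\mathcal{B}(v,\xi;w,-\xi)\ \ge\ c\,\big(\|v\|_1+\|\xi\|_{-1}\big)^2\qquad\text{and}\qquad \|w\|_1\ \le\ C\,\big(\|v\|_1+\|\xi\|_{-1}\big).$$
   Context: $\|v\|_1=(\|\nabla v\|_0^2+\|v\|_0^2)^{1/2}$ is the full $H^1(\Omega)$ norm, $\|\cdot\|_0$ the $L^2(\Omega)$ norm and $(\cdot,\cdot)$ the $L^2(\Omega)$ inner product. $\langle\cdot,\cdot\rangle:V\times Q\to\mathbb{R}$ is the duality pairing, and $\|\xi\|_{-1}=\sup_{0\ne v\in V}\langle v,\xi\rangle/\|v\|_1$. The bilinear form $\mathcal{B}$ on $(V\times Q)\times(V\times Q)$ is $$\mathcal{B}(w,\xi;v,\mu)=(\nabla w,\nabla v)-\langle v,\xi\rangle-\langle w,\mu\rangle .$$ The constants $c,C$ may depend on $\Omega$ but not on $(v,\xi)$. *)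

(* Defs.v *)
From HB Require Import structures.
From mathcomp Require Import all_boot all_order all_algebra.
From mathcomp Require Import all_classical all_reals all_analysis.

Set Implicit Arguments.
Unset Strict Implicit.
Unset Printing Implicit Defensive.

Import Order.TTheory GRing.Theory Num.Theory.
Import numFieldNormedType.Exports.

Local Open Scope classical_set_scope.
Local Open Scope ring_scope.

Notation leb2 := (lebesgue_measure \x lebesgue_measure)%E.

Section Domains.
Context {R : realType}.
Implicit Types (Omega : set (R * R)) (f phi : R * R -> R).

Definition smooth1 (gamma : R -> R) : Prop :=
  forall (n : nat) (x : R), derivable (derive1n n gamma) x 1.

(* Near each boundary point, in suitable orthonormal coordinates (s, t),      *)
(* Omega is the region t > gamma s above the graph of a smooth function.      *)
Definition smooth_boundary Omega : Prop :=
  forall x, (closure Omega `\` Omega) x ->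
  exists (a b : R) (gamma : R -> R),
    [/\ a ^+ 2 + b ^+ 2 = 1, smooth1 gamma &
        \forall y \near x, Omega y <->
          gamma (a * y.1 + b * y.2) < a * y.2 - b * y.1].

Definition smooth_bounded_domain Omega : Prop :=
  [/\ Omega !=set0, open Omega, connected Omega, bounded_set Omega
    & smooth_boundary Omega].

Definition convex_hull_of (n : nat) (p : 'I_n -> R * R) : set (R * R) :=
  [set x | exists t : 'I_n -> R,
     [/\ forall i, 0 <= t i, \sum_i t i = 1 & x = \sum_i t i *: p i]].

(* Polygons are open: the interior of the convex hull of finitely many points *)
(* not all on one line.                                                       *)
Definition convex_polygon Omega : Prop :=
  Omega !=set0 /\
  exists (n : nat) (p : 'I_n -> R * R), Omega = (convex_hull_of p)°.

Definition partial1 f : R * R -> R := fun x => 'D_((1, 0) : R * R) f x.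
Definition partial2 f : R * R -> R := fun x => 'D_((0, 1) : R * R) f x.

Fixpoint C_n (n : nat) f : Prop :=
  continuous f /\
  if n is m.+1 then
    [/\ forall x, derivable f x (1, 0), forall x, derivable f x (0, 1),
        C_n m (partial1 f) & C_n m (partial2 f)]
  else True.

(* C_c^oo(Omega); its elements are extended by 0 to the plane.                *)
Definition test_function Omega : set (R * R -> R) :=
  [set phi | [/\ forall n, C_n n phi,
                 compact (closure [set x | phi x != 0]) &
                 closure [set x | phi x != 0] `<=` Omega]].

End Domains.

(* Functions on Omega are represented by total functions on the plane, whose  *)
(* values outside Omega are irrelevant, and elements of L^2 and H^1_0 by      *)
(* arbitrary representatives of their classes modulo a.e. equality on Omega.  *)
Section Sobolev.
Context {R : realType} (Omega : set (R * R)).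
Implicit Types (u v w phi : R * R -> R) (g : (R * R -> R) * (R * R -> R)).

Definition L2 : set (R * R -> R) :=
  [set u | (u \_ Omega) \in Lfun leb2 2%:E].

Definition L2dot u v : R := \int[leb2]_(x in Omega) (u x * v x).
Definition L2norm u : R := Num.sqrt (L2dot u u).

Definition L2dot2 g h : R := L2dot g.1 h.1 + L2dot g.2 h.2.
Definition L2norm2 g : R := Num.sqrt (L2dot2 g g).

(* u belongs to H^1(Omega), with weak gradient g.                             *)
Definition weak_gradient u g : Prop :=
  [/\ L2 u, L2 g.1, L2 g.2 &
      forall phi, test_function Omega phi ->
        L2dot u (partial1 phi) = - L2dot g.1 phi /\
        L2dot u (partial2 phi) = - L2dot g.2 phi].

(* u belongs to the closure of C_c^oo(Omega) in H^1(Omega), with weak         *)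
(* gradient g.                                                                *)
Definition H10_gradient u g : Prop :=
  weak_gradient u g /\
  forall eps : R, 0 < eps -> exists2 phi, test_function Omega phi &
    Num.sqrt (L2norm2 (g.1 \- partial1 phi, g.2 \- partial2 phi) ^+ 2
              + L2norm (u \- phi) ^+ 2) < eps.

Definition H10 : set (R * R -> R) := [set u | exists g, H10_gradient u g].

(* A representative of the weak gradient, which is unique a.e. on Omega;      *)
(* meaningful for u in H10.                                                   *)
Definition grad u : (R * R -> R) * (R * R -> R) :=
  get [set g | H10_gradient u g].

Definition H1norm u : R := Num.sqrt (L2norm2 (grad u) ^+ 2 + L2norm u ^+ 2).

(* H^{-1}(Omega), the dual of H^1_0(Omega). A functional is given on          *)
(* representatives; linearity and boundedness make it independent of their    *)
(* choice, and its values outside H10 are irrelevant.                         *)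
Definition Hm1 : set ((R * R -> R) -> R) :=
  [set xi | (forall (a : R) u v, H10 u -> H10 v ->
               xi (fun x => a * u x + v x) = a * xi u + xi v) /\
            (exists M : R, forall u, H10 u -> `|xi u| <= M * H1norm u)].

Definition pairing u (xi : (R * R -> R) -> R) : R := xi u.

Definition Hm1norm (xi : (R * R -> R) -> R) : R :=
  sup [set r | exists v, [/\ H10 v,
                             ~ {ae leb2, forall x, Omega x -> v x = 0} &
                             r = pairing v xi / H1norm v]].

Definition bilinB w (xi : (R * R -> R) -> R) v (mu : (R * R -> R) -> R) : R :=
  L2dot2 (grad w) (grad v) - pairing v xi - pairing w mu.

End Sobolev.

(* Main.v *)
(* With N the H^{-1} norm of xi, the definition of the supremum gives q in    *)
(* H^1_0 and a real a with |a q|_1 <= N and xi (a q) >= 3/4 N^2. For          *)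
(* w := v - a q the terms in xi v cancel and Young's inequality gives         *)
(*   B(v, xi; w, -xi) = |grad v|^2 - (grad v, a grad q) + xi (a q)            *)
(*                   >= 1/2 |grad v|^2 + 1/4 N^2,                             *)
(* so the theorem follows from the Poincare inequality. The latter, and the   *)
(* uniqueness of the gradient, come from the definition of the weak gradient: *)
(* an identity satisfied by all test functions and their derivatives passes   *)
(* to their H^1 limits.                                                       *)
Require Import Defs.
From HB Require Import structures.
From mathcomp Require Import all_boot all_order all_algebra.
From mathcomp Require Import all_classical all_reals all_analysis.
From mathcomp Require Import measurable_realfun.
From mathcomp Require Import ring lra.
Import Order.TTheory GRing.Theory Num.Theory.
Import numFieldNormedType.Exports.
Local Open Scope classical_set_scope.
Local Open Scope ring_scope.

(** Since [B(v, xi; w, -xi) = (grad v, grad w) + xi v - xi w], the choice [w = v] controls the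
    gradient of [v] but says nothing about [xi]. Subtracting from [v] a Riesz representative of [xi]
    would add the square of the dual norm; the multiple [a * q] of an almost maximiser of the
    quotient [xi q / |q|_1], from [Hm1norm_almost_attained], takes its place at the cost of a
    constant. Young's inequality absorbs the cross term and [poincare] turns [|grad v|] into the
    full norm. As [grad] is a mere choice of weak gradient, the computation rests on its linearity
    inside inner products, [L2dot2_grad_linear]. This follows from [H10_gradient_unique], which like
    [poincare] is an application of the limit passage [H10_gradient_orthogonal]. *)

(** * Measurability and square integrability on the plane *)

Lemma open_measurable_prod {R : realType} [A : set (R * R)] :
  open A -> measurable A.
Proof.
move=> oA.
pose box (q : (rat * rat) * (rat * rat)) : set (R * R) :=
  `]ratr q.1.1, ratr q.1.2[%classic `*` `]ratr q.2.1, ratr q.2.2[%classic.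
(* Second countability brings an open set into the product sigma-algebra: it is the union of the
   countably many rational boxes that it contains. *)
have -> : A = \bigcup_q (if `[< box q `<=` A >] then box q else set0).
  apply/seteqP; split => [x Ax|x [q _]]; last first.
    by case: asboolP => // qA /qA.
  have /nbhs_ballP[e /= e0 xeA] := open_nbhs_nbhs (conj oA Ax).
  have rat_itv (t : R) : exists ab : rat * rat,
      [/\ ratr ab.1 < t, t < ratr ab.2, t - e < ratr ab.1 & ratr ab.2 < t + e].
    have [a] : exists a : rat, ratr a \in `]t - e, t[.
      by apply: rat_in_itvoo; rewrite ltrBlDr ltrDl.
    have [b] : exists b : rat, ratr b \in `]t, t + e[.
      by apply: rat_in_itvoo; rewrite ltrDl.
    by rewrite !in_itv/= => /andP[? ?] /andP[? ?]; exists (a, b).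
  have [ab [a1 b1 a2 b2]] := rat_itv x.1.
  have [cd [c1 d1 c2 d2]] := rat_itv x.2.
  exists (ab, cd) => //; case: asboolP; last first.
    case=> y [/=]; rewrite !in_itv/= => /andP[y1 y2] /andP[y3 y4].
    apply: xeA; split; rewrite /ball/= ltr_distlC; apply/andP; split.
    - exact: lt_trans y1.
    - exact: lt_trans b2.
    - exact: lt_trans y3.
    - exact: lt_trans d2.
  by move=> _; split; rewrite /= in_itv/=; apply/andP.
apply: countable_bigcupT_measurable => // q.
case: asboolP => // _; apply: measurableX; exact: measurable_itv.
Qed.

Lemma continuous_measurable_fun_prod {R : realType} [f : R * R -> R] :
  continuous f -> measurable_fun setT f.
Proof.
move=> /continuousP cf; apply: (measurability _ (RGenOpens.measurableE R)).
move=> _ [_ [a [b ->] <-]]; rewrite setTI; apply: open_measurable_prod.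
exact/cf/interval_open.
Qed.

Lemma Lfun2_sqr_integrable {d} {T : measurableType d} {R : realType}
    [mu : {measure set T -> \bar R}] [f : T -> R] :
  measurable_fun setT f ->
  mu.-integrable setT (EFin \o (fun x => f x ^+ 2)) -> f \in Lfun mu 2%:E.
Proof.
move=> mf /integrableP[_ fi]; rewrite inE; apply/andP; split; rewrite inE//=.
rewrite /finite_norm unlock poweR_lty//.
under eq_integral => x _ do rewrite abse_EFin poweR_EFin powR_mulrn// -normrX.
exact: fi.
Qed.

Lemma le_Lfun2 {d} {T : measurableType d} {R : realType}
    [mu : {measure set T -> \bar R}] [f g : T -> R] :
  measurable_fun setT f -> (forall x, `|f x| <= `|g x|) ->
  g \in Lfun mu 2%:E -> f \in Lfun mu 2%:E.
Proof.
move=> mf fg /Lfun2_integrable_sqr gi; apply: Lfun2_sqr_integrable => //.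
apply: le_integrable gi => //.
  by apply/measurable_EFinP; exact: measurable_funX.
by move=> x _ /=; rewrite lee_fin !normrX lerXn2r ?nnegrE.
Qed.

Lemma bounded_set_prod {R : realType} [A : set (R * R)] : bounded_set A ->
  exists2 M : R, 0 < M & forall x, A x -> `|x.1| <= M /\ `|x.2| <= M.
Proof.
move=> /= /pinfty_ex_gt0[M M0 AM]; exists M => // x /AM.
by rewrite /= prod_normE ge_max => /andP.
Qed.

Lemma leb2_rectangle_lty {R : realType} (M : R) :
  (leb2 ([set` `[- M, M]%R] `*` [set` `[- M, M]%R] : set (R * R)) < +oo)%E.
Proof.
rewrite product_measure1E//= lebesgue_measure_itv/=.
by case: ifPn => _; rewrite -?EFinD -?EFinM ?mul0e ltry.
Qed.

(** The function is bounded on its compact support and vanishes outside a square of finite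
    measure. *)
Lemma continuous_compact_Lfun2 {R : realType} [f : R * R -> R] :
  continuous f -> compact (closure [set x | f x != 0]) ->
  f \in Lfun leb2 2%:E.
Proof.
move=> cf ck; have mf := continuous_measurable_fun_prod cf.
have [M M0 KM] := bounded_set_prod (compact_bounded ck).
have [B B0 fB] : exists2 B : R, 0 < B &
    forall x, closure [set x | f x != 0] x -> `|f x| <= B.
  have : bounded_set (f @` closure [set x | f x != 0]).
    apply: compact_bounded; apply: continuous_compact => //.
    exact: continuous_subspaceT.
  move=> /= /pinfty_ex_gt0[B B0 fB]; exists B => // x xK.
  by apply: fB; exists x.
pose K : set (R * R) := `[- M, M]%classic `*` `[- M, M]%classic.
have mK : measurable K by apply: measurableX; exact: measurable_itv.
apply: Lfun2_sqr_integrable => //.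
have fK x : ~ K x -> f x = 0.
  move=> xK; apply/eqP; apply: contrapT => /negP fx0; apply: xK.
  have [] := KM x (@subset_closure _ [set x | f x != 0] x fx0).
  by rewrite !ler_norml => ? ?; split; rewrite /= in_itv.
have -> : EFin \o (fun x => f x ^+ 2) = (EFin \o (fun x => f x ^+ 2)) \_ K.
  apply/funext => x; rewrite /= patchE; case: ifPn => //=.
  by move/negP; rewrite inE => /fK ->; rewrite expr0n.
apply/(@integrable_mkcond _ _ _ leb2 K (EFin \o (fun x => f x ^+ 2)) mK).
apply: measurable_bounded_integrable => //.
- exact: leb2_rectangle_lty.
- by apply: measurable_funTS; exact: measurable_funX.
- exists (B ^+ 2); split; first exact: num_real.
  move=> C BC x _ /=; rewrite normrX (le_trans _ (ltW BC))//.
  rewrite lerXn2r ?nnegrE//; first exact: ltW.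
  have [->|fx0] := eqVneq (f x) 0; first by rewrite normr0 ltW.
  by apply: fB; exact: subset_closure.
Qed.

(** * The inner product of [L2 Omega] *)

Lemma restrict_notin {T : Type} {R : realType} (D : set T) (u : T -> R) x :
  x \notin D -> (u \_ D) x = 0.
Proof. by move=> /negPf xD; rewrite patchE xD. Qed.

Lemma restrict_in {T : Type} {R : realType} (D : set T) (u : T -> R) x :
  x \in D -> (u \_ D) x = u x.
Proof. by move=> xD; rewrite patchE xD. Qed.

Lemma restrict_linear {T : Type} {R : realType} (D : set T) (a : R)
    (u v : T -> R) :
  (fun x => a * u x + v x) \_ D = (fun x => a * (u \_ D) x + (v \_ D) x).
Proof.
apply/funext => x.
have [xD|xD] := boolP (x \in D); first by rewrite !restrict_in.
by rewrite !restrict_notin// mulr0 addr0.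
Qed.

Lemma restrict_mul {T : Type} {R : realType} (D : set T) (u v : T -> R) :
  (fun x => u x * v x) \_ D = (u \_ D) \* (v \_ D).
Proof.
apply/funext => x /=.
have [xD|xD] := boolP (x \in D); first by rewrite !restrict_in.
by rewrite !restrict_notin// mulr0.
Qed.

(** The shape [a * u + v], in which [Hm1] states linearity, serves throughout for sums, differences
    and multiples. *)
Lemma L2_linear {R : realType} {Omega : set (R * R)} (a : R)
    {u v : R * R -> R} :
  L2 Omega u -> L2 Omega v -> L2 Omega (fun x => a * u x + v x).
Proof.
rewrite /L2 /= restrict_linear => uL vL.
by apply: (Lfun_submod_closed leb2 _).2 => //; rewrite lee_fin ler1n.
Qed.

Lemma L2dotE {R : realType} (Omega : set (R * R)) u v :
  L2dot Omega u v = \int[leb2]_x ((u \_ Omega) \* (v \_ Omega)) x.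
Proof. by rewrite /L2dot Rintegral_mkcond restrict_mul. Qed.

Lemma L2dot_integrable {R : realType} {Omega : set (R * R)} {u v : R * R -> R} :
  L2 Omega u -> L2 Omega v ->
  leb2.-integrable setT (EFin \o ((u \_ Omega) \* (v \_ Omega))).
Proof. by move=> uL vL; apply/Lfun1_integrable/Lfun2_mul_Lfun1. Qed.

Lemma L2dotC {R : realType} (Omega : set (R * R)) u v :
  L2dot Omega u v = L2dot Omega v u.
Proof. by apply: eq_Rintegral => x _; rewrite mulrC. Qed.

Lemma L2dot_linearl {R : realType} {Omega : set (R * R)} (a : R)
    {u v w : R * R -> R} :
  L2 Omega u -> L2 Omega v -> L2 Omega w ->
  L2dot Omega (fun x => a * u x + v x) w =
    a * L2dot Omega u w + L2dot Omega v w.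
Proof.
move=> uL vL wL; rewrite !L2dotE restrict_linear.
rewrite -RintegralZl//; last exact: L2dot_integrable.
rewrite -RintegralD//; last 2 first.
- exact: (integrableZl _ a (L2dot_integrable uL wL)).
- exact: L2dot_integrable.
by apply: eq_Rintegral => x _ /=; rewrite mulrDl mulrA.
Qed.

Lemma L2dot_linearr {R : realType} {Omega : set (R * R)} (a : R)
    {u v w : R * R -> R} :
  L2 Omega u -> L2 Omega v -> L2 Omega w ->
  L2dot Omega w (fun x => a * u x + v x) =
    a * L2dot Omega w u + L2dot Omega w v.
Proof. by move=> uL vL wL; rewrite !(L2dotC _ w) L2dot_linearl. Qed.

Lemma L2dot_ge0 {R : realType} (Omega : set (R * R)) u : 0 <= L2dot Omega u u.
Proof. by apply: Rintegral_ge0 => x _; rewrite -expr2 sqr_ge0. Qed.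

Lemma L2norm_ge0 {R : realType} (Omega : set (R * R)) u : 0 <= L2norm Omega u.
Proof. exact: sqrtr_ge0. Qed.

Lemma sqr_L2norm {R : realType} (Omega : set (R * R)) u :
  L2norm Omega u ^+ 2 = L2dot Omega u u.
Proof. by rewrite sqr_sqrtr// L2dot_ge0. Qed.

Lemma L2dot_sqr_linear {R : realType} {Omega : set (R * R)} (a : R)
    {u v : R * R -> R} :
  L2 Omega u -> L2 Omega v ->
  L2dot Omega (fun x => a * u x + v x) (fun x => a * u x + v x) =
    a ^+ 2 * L2dot Omega u u + 2 * a * L2dot Omega u v + L2dot Omega v v.
Proof.
move=> uL vL; rewrite L2dot_linearl ?L2dot_linearr//; try exact: L2_linear.
by rewrite (L2dotC _ v u); ring.
Qed.

(** The polynomial [t ^+ 2 * A + 2 * t * B + C], the squared norm of [t * u + v], is nowhere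
    negative. *)
Lemma L2_cauchy_schwarz {R : realType} {Omega : set (R * R)}
    {u v : R * R -> R} :
  L2 Omega u -> L2 Omega v ->
  `|L2dot Omega u v| <= L2norm Omega u * L2norm Omega v.
Proof.
move=> uL vL; rewrite -ler_sqr ?nnegrE ?mulr_ge0 ?L2norm_ge0//.
rewrite real_normK ?num_real// exprMn !sqr_L2norm.
have := L2dot_ge0 Omega.
set A := L2dot Omega u u; set B := L2dot Omega u v; set C := L2dot Omega v v.
move=> dot_ge0; have A0 : 0 <= A := dot_ge0 u.
have q t : 0 <= t ^+ 2 * A + 2 * t * B + C.
  by rewrite -L2dot_sqr_linear.
have [A1|A1] := eqVneq A 0.
  have [->|B1] := eqVneq B 0; first by rewrite expr0n mulr_ge0 ?dot_ge0.
  (* For [A = 0] the polynomial is affine; were [B] nonzero, it would take the value -1 at this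
     point. *)
  have := q (- (C + 1) / (2 * B)); rewrite A1 mulr0 add0r.
  have -> : 2 * (- (C + 1) / (2 * B)) * B + C = -1 by field.
  by rewrite ler0N1.
have Ap : 0 < A by rewrite lt_neqAle eq_sym A1.
(* The minimiser of the polynomial. *)
have := q (- B / A).
have -> : (- B / A) ^+ 2 * A + 2 * (- B / A) * B + C = (A * C - B ^+ 2) / A.
  by field.
by rewrite pmulr_lge0 ?invr_gt0// subr_ge0.
Qed.

Lemma L2_mul_fst {R : realType} {Omega : set (R * R)} {M : R} {u : R * R -> R} :
  (forall x, Omega x -> `|x.1| <= M) ->
  L2 Omega u -> L2 Omega (fun x => x.1 * u x).
Proof.
move=> xM uL.
(* The dominating function is [M * u], written as [(M - 1) * u + u]. *)
apply: le_Lfun2 (L2_linear (M - 1) uL uL).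
  rewrite restrict_mul.
  have -> : (fst \_ Omega) \* (u \_ Omega) = fst \* (u \_ Omega).
    apply/funext => x /=.
    have [xO|xO] := boolP (x \in Omega); first by rewrite !restrict_in.
    by rewrite !restrict_notin// !mulr0.
  apply: measurable_funM; first exact: measurable_fst.
  by have := sub_Lfun_mfun uL; rewrite inE.
move=> x; have [xO|xO] := boolP (x \in Omega); last first.
  by rewrite !restrict_notin// normr0.
rewrite !restrict_in// mulrBl mul1r subrK !normrM; apply: ler_wpM2r => //.
by rewrite (le_trans (xM x _)) ?ler_norm//; move: xO; rewrite inE.
Qed.

Lemma L2dot_mul_fst_le {R : realType} {Omega : set (R * R)} {M : R}
    {u : R * R -> R} :
  (forall x, Omega x -> `|x.1| <= M) -> L2 Omega u ->
  L2dot Omega (fun x => x.1 * u x) (fun x => x.1 * u x)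
    <= M ^+ 2 * L2dot Omega u u.
Proof.
move=> xM uL; have xuL := L2_mul_fst xM uL.
rewrite !L2dotE -RintegralZl//; last exact: L2dot_integrable.
apply: le_Rintegral => //; first exact: L2dot_integrable.
  exact: (integrableZl _ (M ^+ 2) (L2dot_integrable uL uL)).
move=> x _ /=; have [xO|xO] := boolP (x \in Omega); last first.
  by rewrite !restrict_notin// !mulr0.
rewrite !restrict_in//; move: xO; rewrite inE => /xM xM1.
rewrite mulrACA -!expr2 ler_wpM2r ?sqr_ge0//.
by rewrite -[leLHS]real_normK ?num_real// ler_sqr ?nnegrE// (le_trans _ xM1).
Qed.

(** * Differentiation rules and the classes [C_n] *)

Lemma is_derive_fst {R : realType} (x v : R * R) :
  is_derive x v (fst : R * R -> R) v.1.
Proof.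
have cv : (fun h : R => h^-1 *: ((h *: v + x).1 - x.1)) @ 0^' --> v.1.
  apply: cvg_near_cst; near=> h.
  have h0 : h != 0 by near: h; exact: nbhs_dnbhs_neq.
  by rewrite /= addrK /GRing.scale/= mulrA mulVf// mul1r.
by apply: DeriveDef; [exact: cvgP cv|exact: cvg_lim cv].
Unshelve. all: by end_near. Qed.

Lemma is_derive_linear {R : realType} (a : R) {f g : R * R -> R}
    {x v : R * R} :
  derivable f x v -> derivable g x v ->
  is_derive x v (fun y => a * f y + g y) (a * 'D_v f x + 'D_v g x).
Proof.
move=> /derivableP df /derivableP dg.
exact: (is_deriveD (is_deriveZ a df) dg).
Qed.

Lemma is_derive_mul_fst {R : realType} {f : R * R -> R} {x v : R * R} :
  derivable f x v ->
  is_derive x v (fun y => y.1 * f y) (x.1 * 'D_v f x + v.1 * f x).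
Proof.
move=> /derivableP df; have := is_deriveM (is_derive_fst x v) df.
by move/is_derive_eq; apply; rewrite [f x *: _]mulrC.
Qed.

Lemma C_n_continuous {R : realType} {n} {f : R * R -> R} :
  C_n n f -> continuous f.
Proof. by case: n => [|n] []. Qed.

Lemma C_nS {R : realType} n (f : R * R -> R) :
  C_n n.+1 f <->
  continuous f /\ [/\ forall x, derivable f x (1, 0),
    forall x, derivable f x (0, 1), C_n n (partial1 f) & C_n n (partial2 f)].
Proof. by []. Qed.

Lemma C_n_le {R : realType} n (f : R * R -> R) : C_n n.+1 f -> C_n n f.
Proof.
elim: n f => [|n IHn] f; first by case.
move=> /C_nS[cf [f1 f2 pf1 pf2]]; apply/C_nS; split; first exact: cf.
by split; [exact: f1|exact: f2|exact: IHn|exact: IHn].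
Qed.

Lemma C_n_linear {R : realType} n (a : R) (f g : R * R -> R) :
  C_n n f -> C_n n g -> C_n n (fun x => a * f x + g x).
Proof.
elim: n f g => [|n IHn] f g Cf Cg;
  have cfg : continuous (fun x => a * f x + g x) by
    move=> x; apply: cvgD; [apply: cvgM;
      [exact: cvg_cst|exact: (C_n_continuous Cf)]|exact: (C_n_continuous Cg)].
  by split.
move: Cf Cg => /C_nS[_ [f1 f2 pf1 pf2]] /C_nS[_ [g1 g2 pg1 pg2]].
apply/C_nS; split; first exact: cfg.
have D1 x := is_derive_linear a (f1 x) (g1 x).
have D2 x := is_derive_linear a (f2 x) (g2 x).
split.
- by move=> x; case: (D1 x).
- by move=> x; case: (D2 x).
- rewrite (_ : partial1 _ = fun x => a * partial1 f x + partial1 g x).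
    exact: IHn.
  by apply/funext => x; case: (D1 x).
- rewrite (_ : partial2 _ = fun x => a * partial2 f x + partial2 g x).
    exact: IHn.
  by apply/funext => x; case: (D2 x).
Qed.

Lemma partial1_mul_fst {R : realType} {f : R * R -> R} :
  (forall x, derivable f x (1, 0)) ->
  partial1 (fun x => x.1 * f x) = (fun x => x.1 * partial1 f x + f x).
Proof.
move=> f1; apply/funext => x.
by have [_] := is_derive_mul_fst (f1 x); rewrite mul1r.
Qed.

(** This makes [x.1 * phi] admissible as a test function in the Poincare inequality. The extra
    summand [f] in the first partial derivative only has to be one order less regular, which is
    [C_n_le]. *)
Lemma C_n_mul_fst {R : realType} n (f : R * R -> R) :
  C_n n f -> C_n n (fun x => x.1 * f x).
Proof.
elim: n f => [|n IHn] f Cf;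
  have cf : continuous (fun x : R * R => x.1 * f x) by
    move=> x; apply: cvgM; [exact: cvg_fst|exact: (C_n_continuous Cf)].
  by split.
have /C_nS[_ [f1 f2 pf1 pf2]] := Cf; apply/C_nS; split; first exact: cf.
split.
- by move=> x; case: (is_derive_mul_fst (f1 x)).
- by move=> x; case: (is_derive_mul_fst (f2 x)).
- rewrite partial1_mul_fst//.
  rewrite (_ : (fun x => _) = fun x => 1 * (x.1 * partial1 f x) + f x).
    by apply: C_n_linear; [exact: IHn|exact: C_n_le].
  by apply/funext => x; rewrite mul1r.
- rewrite (_ : partial2 _ = fun x => x.1 * partial2 f x); first exact: IHn.
  apply/funext => x.
  by have [_] := is_derive_mul_fst (f2 x); rewrite mul0r addr0.
Qed.

(** * Test functions *)

(** Off its closed support [f] is zero near each point, hence so are its derivatives. *)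
Lemma support_derive {R : realType} (f : R * R -> R) (v : R * R) :
  closure [set x | 'D_v f x != 0] `<=` closure [set x | f x != 0].
Proof.
have -> : closure [set x | f x != 0] = closure (closure [set x | f x != 0]).
  by apply/closure_id; exact: closed_closure.
apply: closureS => x /= Dfx; apply: contrapT => xS.
move/eqP: Dfx; apply.
have -> : 'D_v f x = 'D_v (cst 0) x; last exact: derive_cst.
apply: near_eq_derive.
have : nbhs x (~` closure [set x | f x != 0]).
  by apply: open_nbhs_nbhs; split => //; apply: closed_openC;
    exact: closed_closure.
apply: filterS => y /= yS; apply/eqP; apply: contrapT => /negP fy.
by apply: yS; apply: subset_closure.
Qed.

Lemma test_function_support {R : realType} {Omega : set (R * R)}
    {phi psi : R * R -> R} :
  test_function Omega phi -> (forall n, C_n n psi) ->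
  closure [set x | psi x != 0] `<=` closure [set x | phi x != 0] ->
  test_function Omega psi.
Proof.
move=> [_ kphi phiO] Cpsi psiphi; split => //.
  exact: subclosed_compact (@closed_closure _ _) kphi psiphi.
exact: subset_trans psiphi phiO.
Qed.

Lemma test_function_partial1 {R : realType} {Omega : set (R * R)}
    {phi : R * R -> R} :
  test_function Omega phi -> test_function Omega (partial1 phi).
Proof.
move=> tphi; have [Cphi _ _] := tphi.
apply: test_function_support tphi _ (@support_derive _ _ _) => n.
by have /C_nS[_ []] := Cphi n.+1.
Qed.

Lemma test_function_partial2 {R : realType} {Omega : set (R * R)}
    {phi : R * R -> R} :
  test_function Omega phi -> test_function Omega (partial2 phi).
Proof.
move=> tphi; have [Cphi _ _] := tphi.
apply: test_function_support tphi _ (@support_derive _ _ _) => n.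
by have /C_nS[_ []] := Cphi n.+1.
Qed.

Lemma test_function_mul_fst {R : realType} {Omega : set (R * R)}
    {phi : R * R -> R} :
  test_function Omega phi -> test_function Omega (fun x => x.1 * phi x).
Proof.
move=> tphi; have [Cphi _ _] := tphi.
apply: test_function_support tphi _ _ => [n|]; first exact: C_n_mul_fst.
by apply: closureS => x /=; apply: contra_neq => ->; rewrite mulr0.
Qed.

Lemma test_function_linear {R : realType} {Omega : set (R * R)} (a : R)
    {phi psi : R * R -> R} :
  test_function Omega phi -> test_function Omega psi ->
  test_function Omega (fun x => a * phi x + psi x).
Proof.
move=> [Cphi kphi phiO] [Cpsi kpsi psiO].
have sub : closure [set x | a * phi x + psi x != 0] `<=`
    closure [set x | phi x != 0] `|` closure [set x | psi x != 0].
  rewrite -closureU; apply: closureS => x /= h.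
  have [phix|] := eqVneq (phi x) 0; last by left.
  by right; apply: contra_neq h => ->; rewrite phix mulr0 addr0.
split => [n||]; first exact: C_n_linear.
  exact: subclosed_compact (@closed_closure _ _) (compactU kphi kpsi) sub.
by apply: subset_trans sub _; rewrite subUset.
Qed.

Lemma test_function_derivable1 {R : realType} {Omega : set (R * R)}
    {phi : R * R -> R} :
  test_function Omega phi -> forall x, derivable phi x (1, 0).
Proof. by move=> [/(_ 1%N)/C_nS[_ []]]. Qed.

Lemma test_function_derivable2 {R : realType} {Omega : set (R * R)}
    {phi : R * R -> R} :
  test_function Omega phi -> forall x, derivable phi x (0, 1).
Proof. by move=> [/(_ 1%N)/C_nS[_ []]]. Qed.

(** A test function already vanishes outside [Omega], so the restriction does not change it. *)
Lemma test_function_L2 {R : realType} {Omega : set (R * R)}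
    {phi : R * R -> R} :
  test_function Omega phi -> L2 Omega phi.
Proof.
move=> [Cphi kphi phiO]; rewrite /L2/=.
suff -> : phi \_ Omega = phi.
  by apply: continuous_compact_Lfun2 => //; exact: (C_n_continuous (Cphi 0%N)).
apply/funext => x; have [xO|xO] := boolP (x \in Omega).
  by rewrite restrict_in.
rewrite restrict_notin//; apply/esym/eqP; apply: contraNT xO => phix.
by rewrite inE; apply: phiO; apply: subset_closure.
Qed.

(** * Further rules for the inner product *)

Lemma L2_0 {R : realType} {Omega : set (R * R)} : L2 Omega (fun=> 0).
Proof.
rewrite /L2/= (_ : _ \_ _ = 0); last first.
  apply/funext => x; have [xO|xO] := boolP (x \in Omega).
    by rewrite restrict_in.
  by rewrite restrict_notin.
by apply: (Lfun_submod_closed leb2 _).1; rewrite lee_fin ler1n.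
Qed.

Lemma L2dot0l {R : realType} (Omega : set (R * R)) u :
  L2dot Omega (fun=> 0) u = 0.
Proof.
rewrite /L2dot /Rintegral.
by under eq_integral => x _ do rewrite mul0r; rewrite integral0.
Qed.

Lemma subfunE {R : realType} (u v : R * R -> R) :
  u \- v = fun x => -1 * v x + u x.
Proof. by apply/funext => x /=; rewrite mulN1r addrC. Qed.

Lemma L2_sub {R : realType} {Omega : set (R * R)} {u v : R * R -> R} :
  L2 Omega u -> L2 Omega v -> L2 Omega (u \- v).
Proof. by move=> uL vL; rewrite subfunE; exact: L2_linear. Qed.

Lemma L2dot_subr {R : realType} {Omega : set (R * R)} {u v w : R * R -> R} :
  L2 Omega u -> L2 Omega v -> L2 Omega w ->
  L2dot Omega w (u \- v) = L2dot Omega w u - L2dot Omega w v.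
Proof.
by move=> uL vL wL; rewrite subfunE L2dot_linearr// mulN1r addrC.
Qed.

Lemma L2dot_mul_fst {R : realType} (Omega : set (R * R)) u v :
  L2dot Omega (fun x => x.1 * u x) v = L2dot Omega u (fun x => x.1 * v x).
Proof. by apply: eq_Rintegral => x _; rewrite mulrCA mulrA. Qed.

(** The parallelogram law for [a * u] and [v], with the square of [- a * u + v] dropped. *)
Lemma L2dot_sqr_linear_le {R : realType} {Omega : set (R * R)} (a : R)
    {u v : R * R -> R} :
  L2 Omega u -> L2 Omega v ->
  L2dot Omega (fun x => a * u x + v x) (fun x => a * u x + v x) <=
    2 * a ^+ 2 * L2dot Omega u u + 2 * L2dot Omega v v.
Proof.
move=> uL vL; rewrite L2dot_sqr_linear//.
have := L2dot_ge0 Omega (fun x => - a * u x + v x).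
rewrite L2dot_sqr_linear// sqrrN.
have aux (UU UV VV : R) : 0 <= a ^+ 2 * UU + 2 * - a * UV + VV ->
    a ^+ 2 * UU + 2 * a * UV + VV <= 2 * a ^+ 2 * UU + 2 * VV.
  by clear; lra.
exact: aux.
Qed.

(** * Weak gradients of limits of test functions: linearity and uniqueness *)

(** The squared [H^1] distance between [u], with candidate gradient [g], and [phi]. Squares keep the
    estimates polynomial, and [g] is a parameter because uniqueness of the gradient is still to be
    shown. *)
Definition H1dist2 {R : realType} (Omega : set (R * R)) u
    (g : (R * R -> R) * (R * R -> R)) (phi : R * R -> R) : R :=
  L2dot Omega (g.1 \- partial1 phi) (g.1 \- partial1 phi)
  + L2dot Omega (g.2 \- partial2 phi) (g.2 \- partial2 phi)
  + L2dot Omega (u \- phi) (u \- phi).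

Lemma H1dist2E {R : realType} (Omega : set (R * R)) u g phi :
  L2norm2 Omega (g.1 \- partial1 phi, g.2 \- partial2 phi) ^+ 2
    + L2norm Omega (u \- phi) ^+ 2 = H1dist2 Omega u g phi.
Proof. by rewrite sqr_L2norm sqr_sqrtr// addr_ge0 ?L2dot_ge0. Qed.

Lemma H10_gradientP {R : realType} {Omega : set (R * R)} {u : R * R -> R}
    {g : (R * R -> R) * (R * R -> R)} :
  H10_gradient Omega u g <-> weak_gradient Omega u g /\
  forall eps : R, 0 < eps ->
    exists2 phi, test_function Omega phi & H1dist2 Omega u g phi < eps.
Proof.
split=> -[gu ug]; split=> // eps eps0.
  have [|phi tphi] := ug (Num.sqrt eps); first by rewrite sqrtr_gt0.
  by rewrite H1dist2E ltr_sqrt//; exists phi.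
have [|phi tphi uphi] := ug (eps ^+ 2); first exact: exprn_gt0.
exists phi => //; rewrite H1dist2E.
by rewrite -[ltRHS](gtr0_norm eps0) -sqrtr_sqr ltr_sqrt// exprn_gt0.
Qed.

Lemma weak_gradient_linear {R : realType} {Omega : set (R * R)} (a : R)
    {u v : R * R -> R} {g h : (R * R -> R) * (R * R -> R)} :
  weak_gradient Omega u g -> weak_gradient Omega v h ->
  weak_gradient Omega (fun x => a * u x + v x)
    (fun x => a * g.1 x + h.1 x, fun x => a * g.2 x + h.2 x).
Proof.
move=> [uL g1L g2L ug] [vL h1L h2L vh]; split; rewrite /=; try exact: L2_linear.
move=> phi tphi; have phiL := test_function_L2 tphi.
have phi1L := test_function_L2 (test_function_partial1 tphi).
have phi2L := test_function_L2 (test_function_partial2 tphi).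
have [ug1 ug2] := ug _ tphi; have [vh1 vh2] := vh _ tphi.
by split; rewrite !L2dot_linearl// opprD -mulrN; congr (_ * _ + _).
Qed.

Lemma sub_linear {R : realType} (a : R) (u v phi psi : R * R -> R) :
  (fun x => a * u x + v x) \- (fun x => a * phi x + psi x) =
  (fun x => a * (u \- phi) x + (v \- psi) x).
Proof. by apply/funext => x /=; ring. Qed.

Lemma partial1_linear {R : realType} {Omega : set (R * R)} (a : R)
    {phi psi : R * R -> R} :
  test_function Omega phi -> test_function Omega psi ->
  partial1 (fun x => a * phi x + psi x) =
    (fun x => a * partial1 phi x + partial1 psi x).
Proof.
move=> tphi tpsi; apply/funext => x.
by case: (is_derive_linear a (test_function_derivable1 tphi x)
  (test_function_derivable1 tpsi x)).
Qed.

Lemma partial2_linear {R : realType} {Omega : set (R * R)} (a : R)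
    {phi psi : R * R -> R} :
  test_function Omega phi -> test_function Omega psi ->
  partial2 (fun x => a * phi x + psi x) =
    (fun x => a * partial2 phi x + partial2 psi x).
Proof.
move=> tphi tpsi; apply/funext => x.
by case: (is_derive_linear a (test_function_derivable2 tphi x)
  (test_function_derivable2 tpsi x)).
Qed.

Lemma H10_gradient_linear {R : realType} {Omega : set (R * R)} (a : R)
    {u v : R * R -> R} {g h : (R * R -> R) * (R * R -> R)} :
  H10_gradient Omega u g -> H10_gradient Omega v h ->
  H10_gradient Omega (fun x => a * u x + v x)
    (fun x => a * g.1 x + h.1 x, fun x => a * g.2 x + h.2 x).
Proof.
move=> /H10_gradientP[ug apu] /H10_gradientP[vh apv]; apply/H10_gradientP.
split=> [|eps eps0]; first exact: weak_gradient_linear.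
have d0 : 0 < 2 * a ^+ 2 + 2 by rewrite ltr_wpDl// mulr_ge0// sqr_ge0.
(* Chosen so that the bound [le2] adds up to [2 * a ^+ 2 * d + 2 * d = eps]. *)
pose d := eps / (2 * a ^+ 2 + 2).
have dp : 0 < d by rewrite divr_gt0.
have [phi tphi uphi] := apu _ dp; have [psi tpsi vpsi] := apv _ dp.
exists (fun x => a * phi x + psi x); first exact: test_function_linear.
have [uL g1L g2L _] := ug; have [vL h1L h2L _] := vh.
have phiL := test_function_L2 tphi; have psiL := test_function_L2 tpsi.
have phi1L := test_function_L2 (test_function_partial1 tphi).
have phi2L := test_function_L2 (test_function_partial2 tphi).
have psi1L := test_function_L2 (test_function_partial1 tpsi).
have psi2L := test_function_L2 (test_function_partial2 tpsi).
have le2 : H1dist2 Omega (fun x => a * u x + v x)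
    (fun x => a * g.1 x + h.1 x, fun x => a * g.2 x + h.2 x)
    (fun x => a * phi x + psi x)
  <= 2 * a ^+ 2 * H1dist2 Omega u g phi + 2 * H1dist2 Omega v h psi.
  rewrite /H1dist2 (partial1_linear a tphi tpsi) (partial2_linear a tphi tpsi).
  rewrite /= !sub_linear.
  have l1 := L2dot_sqr_linear_le a (L2_sub g1L phi1L) (L2_sub h1L psi1L).
  have l2 := L2dot_sqr_linear_le a (L2_sub g2L phi2L) (L2_sub h2L psi2L).
  have l3 := L2dot_sqr_linear_le a (L2_sub uL phiL) (L2_sub vL psiL).
  have aux (c A1 A2 A3 B1 B2 B3 C1 C2 C3 : R) : A1 <= c * B1 + 2 * C1 ->
      A2 <= c * B2 + 2 * C2 -> A3 <= c * B3 + 2 * C3 ->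
      A1 + A2 + A3 <= c * (B1 + B2 + B3) + 2 * (C1 + C2 + C3).
    by clear; lra.
  exact: aux.
apply: (le_lt_trans le2).
have -> : eps = 2 * a ^+ 2 * d + 2 * d.
  by rewrite -mulrDl mulrC divfK// gt_eqF.
apply: ler_ltD; last by rewrite ltr_pM2l.
by apply: ler_wpM2l (ltW uphi); rewrite mulr_ge0 ?sqr_ge0.
Qed.

(** By Cauchy-Schwarz the left side is continuous in the [H^1] distance, so its vanishing on test
    functions passes to their limits. *)
Lemma H10_gradient_orthogonal {R : realType} {Omega : set (R * R)}
    {f1 f2 h u : R * R -> R} {g : (R * R -> R) * (R * R -> R)} :
  L2 Omega f1 -> L2 Omega f2 -> L2 Omega h ->
  (forall phi, test_function Omega phi ->
    L2dot Omega f1 (partial1 phi) + L2dot Omega f2 (partial2 phi)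
      + L2dot Omega h phi = 0) ->
  H10_gradient Omega u g ->
  L2dot Omega f1 g.1 + L2dot Omega f2 g.2 + L2dot Omega h u = 0.
Proof.
move=> f1L f2L hL orth /H10_gradientP[[uL g1L g2L _] apu].
set X := LHS; apply/eqP; rewrite -normr_le0; apply/ler_addgt0Pr => eps eps0.
rewrite add0r; set K := L2norm Omega f1 + L2norm Omega f2 + L2norm Omega h.
have K0 : 0 <= K by rewrite !addr_ge0 ?L2norm_ge0.
(* The error is at most [K * d <= eps]; adding 1 keeps the denominator positive when [K = 0]. *)
pose d := eps / (K + 1).
have d0 : 0 < d by rewrite divr_gt0// ltr_wpDl.
have [phi tphi uphi] := apu (d ^+ 2) (exprn_gt0 _ d0).
have phiL := test_function_L2 tphi.
have phi1L := test_function_L2 (test_function_partial1 tphi).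
have phi2L := test_function_L2 (test_function_partial2 tphi).
have dist_lt (w : R * R -> R) : L2dot Omega w w <= H1dist2 Omega u g phi ->
    L2norm Omega w <= d.
  move=> wphi; rewrite -ler_sqr ?nnegrE ?L2norm_ge0 ?(ltW d0)//.
  by rewrite sqr_L2norm (le_trans wphi)// ltW.
have -> : X = L2dot Omega f1 (g.1 \- partial1 phi)
    + L2dot Omega f2 (g.2 \- partial2 phi) + L2dot Omega h (u \- phi).
  rewrite !L2dot_subr//; have := orth _ tphi; rewrite /X.
  by do !move: (L2dot _ _ _) => ?; lra.
have e1 : `|L2dot Omega f1 (g.1 \- partial1 phi)| <= L2norm Omega f1 * d.
  apply: (le_trans (L2_cauchy_schwarz f1L (L2_sub g1L phi1L))).
  apply: ler_wpM2l; first exact: L2norm_ge0.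
  by apply: dist_lt; rewrite /H1dist2 -addrA lerDl addr_ge0 ?L2dot_ge0.
have e2 : `|L2dot Omega f2 (g.2 \- partial2 phi)| <= L2norm Omega f2 * d.
  apply: (le_trans (L2_cauchy_schwarz f2L (L2_sub g2L phi2L))).
  apply: ler_wpM2l; first exact: L2norm_ge0.
  by apply: dist_lt; rewrite /H1dist2 addrAC lerDr addr_ge0 ?L2dot_ge0.
have e3 : `|L2dot Omega h (u \- phi)| <= L2norm Omega h * d.
  apply: (le_trans (L2_cauchy_schwarz hL (L2_sub uL phiL))).
  apply: ler_wpM2l; first exact: L2norm_ge0.
  by apply: dist_lt; rewrite /H1dist2 lerDr addr_ge0 ?L2dot_ge0.
apply: (@le_trans _ _ (K * d)).
  rewrite /K !mulrDl (le_trans (ler_normD _ _))// lerD//.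
  by rewrite (le_trans (ler_normD _ _))// lerD.
by rewrite /d mulrCA ger_pMr// ler_pdivrMr ?mul1r ?lerDl// ltr_wpDl.
Qed.

(** The difference of two gradients of [u] is orthogonal to all test functions, in particular to
    their derivatives. In the limit each component is orthogonal to the corresponding components of
    both gradients, hence to itself, so it has norm 0. Equality is stated under inner products, the
    only way gradients enter the norms and the bilinear form. *)
Lemma H10_gradient_unique {R : realType} {Omega : set (R * R)}
    {u f : R * R -> R} {g g' : (R * R -> R) * (R * R -> R)} :
  L2 Omega f -> H10_gradient Omega u g -> H10_gradient Omega u g' ->
  L2dot Omega f g.1 = L2dot Omega f g'.1 /\
  L2dot Omega f g.2 = L2dot Omega f g'.2.
Proof.
move=> fL ug ug'.
have [[uL g1L g2L wug] _] := ug; have [[_ g1L' g2L' wug'] _] := ug'.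
pose d1 := g.1 \- g'.1; pose d2 := g.2 \- g'.2.
have d1L : L2 Omega d1 := L2_sub g1L g1L'.
have d2L : L2 Omega d2 := L2_sub g2L g2L'.
have d_orth phi : test_function Omega phi ->
    L2dot Omega d1 phi = 0 /\ L2dot Omega d2 phi = 0.
  move=> tphi; have phiL := test_function_L2 tphi.
  rewrite !(L2dotC _ _ phi) !L2dot_subr// !(L2dotC _ phi).
  have [e1 e2] := wug _ tphi; have [e1' e2'] := wug' _ tphi.
  by split; apply/eqP; rewrite subr_eq0 -eqr_opp -?e1 -?e2 -?e1' -?e2'.
have orth1 g0 : H10_gradient Omega u g0 -> L2dot Omega d1 g0.1 = 0.
  move=> /(H10_gradient_orthogonal d1L L2_0 L2_0).
  rewrite !L2dot0l !addr0; apply => phi tphi.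
  by rewrite !L2dot0l !addr0; case: (d_orth _ (test_function_partial1 tphi)).
have orth2 g0 : H10_gradient Omega u g0 -> L2dot Omega d2 g0.2 = 0.
  move=> /(H10_gradient_orthogonal L2_0 d2L L2_0).
  rewrite !L2dot0l addr0 add0r; apply => phi tphi.
  rewrite !L2dot0l addr0 add0r.
  by case: (d_orth _ (test_function_partial2 tphi)).
have null_orth d : L2 Omega d -> L2dot Omega d d = 0 -> L2dot Omega f d = 0.
  move=> dL dd0; apply/eqP; rewrite -normr_le0.
  by rewrite (le_trans (L2_cauchy_schwarz fL dL))// /L2norm dd0 sqrtr0 mulr0.
split; apply/eqP; rewrite -subr_eq0 -L2dot_subr//; apply/eqP; apply: null_orth.
- exact: d1L.
- by rewrite [LHS]L2dot_subr// !orth1// subrr.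
- exact: d2L.
- by rewrite [LHS]L2dot_subr// !orth2// subrr.
Qed.

(** * The chosen gradient *)

Lemma grad_spec {R : realType} {Omega : set (R * R)} {u : R * R -> R} :
  H10 Omega u -> H10_gradient Omega u (grad Omega u).
Proof. by move=> ug; exact: getPex ug. Qed.

Lemma grad_L2 {R : realType} {Omega : set (R * R)} {u : R * R -> R} :
  H10 Omega u ->
  [/\ L2 Omega u, L2 Omega (grad Omega u).1 & L2 Omega (grad Omega u).2].
Proof. by move=> /grad_spec[[]]. Qed.

Lemma H10_linear {R : realType} {Omega : set (R * R)} (a : R)
    {u v : R * R -> R} :
  H10 Omega u -> H10 Omega v -> H10 Omega (fun x => a * u x + v x).
Proof.
move=> /grad_spec ug /grad_spec vh; eexists.
exact: H10_gradient_linear ug vh.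
Qed.

(** The chosen gradient of [a * u + v] need not be the combination of the chosen gradients as a
    function, but both are gradients of [a * u + v], so uniqueness equates their inner products with
    [F]. *)
Lemma L2dot2_grad_linear {R : realType} {Omega : set (R * R)} (a : R)
    {u v : R * R -> R}
    {F : (R * R -> R) * (R * R -> R)} :
  L2 Omega F.1 -> L2 Omega F.2 -> H10 Omega u -> H10 Omega v ->
  L2dot2 Omega F (grad Omega (fun x => a * u x + v x)) =
    a * L2dot2 Omega F (grad Omega u) + L2dot2 Omega F (grad Omega v).
Proof.
move=> F1L F2L uH vH; have wH := grad_spec (H10_linear a uH vH).
have wH' := H10_gradient_linear a (grad_spec uH) (grad_spec vH).
have [_ u1L u2L] := grad_L2 uH; have [_ v1L v2L] := grad_L2 vH.
have [e1 _] := H10_gradient_unique F1L wH wH'.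
have [_ e2] := H10_gradient_unique F2L wH wH'.
transitivity (L2dot2 Omega F
  (fun x => a * (grad Omega u).1 x + (grad Omega v).1 x,
   fun x => a * (grad Omega u).2 x + (grad Omega v).2 x)).
  by congr (_ + _).
by rewrite /L2dot2 /= !L2dot_linearr// mulrDr; exact: addrACA.
Qed.

Lemma L2dot2C {R : realType} (Omega : set (R * R)) F G :
  L2dot2 Omega F G = L2dot2 Omega G F.
Proof. by rewrite /L2dot2 L2dotC (L2dotC _ F.2). Qed.

Lemma L2dot2_ge0 {R : realType} (Omega : set (R * R)) F :
  0 <= L2dot2 Omega F F.
Proof. by rewrite addr_ge0 ?L2dot_ge0. Qed.

Lemma L2dot2_grad_sqr_linear {R : realType} {Omega : set (R * R)} (a : R)
    {u v : R * R -> R} (w := fun x => a * u x + v x) :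
  H10 Omega u -> H10 Omega v ->
  L2dot2 Omega (grad Omega w) (grad Omega w) =
    a ^+ 2 * L2dot2 Omega (grad Omega u) (grad Omega u)
    + 2 * a * L2dot2 Omega (grad Omega u) (grad Omega v)
    + L2dot2 Omega (grad Omega v) (grad Omega v).
Proof.
move=> uH vH; have [_ w1L w2L] := grad_L2 (H10_linear a uH vH).
have [_ u1L u2L] := grad_L2 uH; have [_ v1L v2L] := grad_L2 vH.
have ww := L2dot2_grad_linear a w1L w2L uH vH.
have wu := etrans (L2dot2C _ _ _) (L2dot2_grad_linear a u1L u2L uH vH).
have wv := etrans (L2dot2C _ _ _) (L2dot2_grad_linear a v1L v2L uH vH).
have aux (WW WU WV UU UV VU VV : R) : WW = a * WU + WV -> WU = a * UU + UV ->
    WV = a * VU + VV -> VU = UV -> WW = a ^+ 2 * UU + 2 * a * UV + VV.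
  by clear=> -> -> -> ->; ring.
exact: aux ww wu wv (L2dot2C _ _ _).
Qed.

(** * The [H^1] norm and the Poincare inequality *)

Lemma H1norm_ge0 {R : realType} (Omega : set (R * R)) u : 0 <= H1norm Omega u.
Proof. exact: sqrtr_ge0. Qed.

Lemma sqr_H1norm {R : realType} (Omega : set (R * R)) u :
  H1norm Omega u ^+ 2 =
    L2dot2 Omega (grad Omega u) (grad Omega u) + L2dot Omega u u.
Proof.
rewrite sqr_sqrtr; last by rewrite addr_ge0 ?sqr_ge0.
by rewrite sqr_L2norm sqr_sqrtr// L2dot2_ge0.
Qed.

Lemma sqr_H1norm_linear_le {R : realType} {Omega : set (R * R)} (a : R)
    {u v : R * R -> R} :
  H10 Omega u -> H10 Omega v ->
  H1norm Omega (fun x => a * u x + v x) ^+ 2 <=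
    2 * a ^+ 2 * H1norm Omega u ^+ 2 + 2 * H1norm Omega v ^+ 2.
Proof.
move=> uH vH; have [uL _ _] := grad_L2 uH; have [vL _ _] := grad_L2 vH.
have l2 := L2dot_sqr_linear_le a uL vL.
have gp := L2dot2_grad_sqr_linear a uH vH.
have gm := L2dot2_grad_sqr_linear (- a) uH vH.
have g0 := L2dot2_ge0 Omega (grad Omega (fun x => - a * u x + v x)).
rewrite !sqr_H1norm.
have aux (P M UU UV VV L U V : R) : P = a ^+ 2 * UU + 2 * a * UV + VV ->
    M = (- a) ^+ 2 * UU + 2 * - a * UV + VV -> 0 <= M ->
    L <= 2 * a ^+ 2 * U + 2 * V ->
    P + L <= 2 * a ^+ 2 * (UU + U) + 2 * (VV + V).
  by clear=> -> ->; rewrite sqrrN; lra.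
exact: aux gp gm g0 l2.
Qed.

(* Testing the weak gradient against [x.1 * phi] and letting [phi] tend to u  *)
(* gives |u|^2 = - 2 (x.1 * d_1 u, u).                                        *)
Lemma poincare {R : realType} {Omega : set (R * R)} {M : R} {u : R * R -> R} :
  (forall x, Omega x -> `|x.1| <= M) -> H10 Omega u ->
  L2dot Omega u u <=
    4 * M ^+ 2 * L2dot2 Omega (grad Omega u) (grad Omega u).
Proof.
move=> xM uH; have ug := grad_spec uH; have [[uL g1L g2L wug] _] := ug.
move: (grad Omega u) => g in ug g1L g2L wug *.
have xuL := L2_mul_fst xM uL; have xgL := L2_mul_fst xM g1L.
have hL := L2_linear 1 xgL uL.
have orth phi : test_function Omega phi ->
    L2dot Omega (fun x => x.1 * u x) (partial1 phi)
      + L2dot Omega (fun=> 0) (partial2 phi)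
      + L2dot Omega (fun x => 1 * (x.1 * g.1 x) + u x) phi = 0.
  move=> tphi; have phiL := test_function_L2 tphi.
  have phi1L := test_function_L2 (test_function_partial1 tphi).
  (* With [x.1 * phi] as test function, the product rule gives [(u, x.1 * d_1 phi + phi) = - (g.1,
     x.1 * phi)]. *)
  have [+ _] := wug _ (test_function_mul_fst tphi).
  rewrite (partial1_mul_fst (test_function_derivable1 tphi)).
  have -> : (fun x => x.1 * partial1 phi x + phi x) =
      (fun x => 1 * (x.1 * partial1 phi x) + phi x).
    by apply/funext => x; rewrite mul1r.
  rewrite (L2dot_linearr 1 (L2_mul_fst xM phi1L) phiL uL) mul1r => e.
  rewrite L2dot0l addr0 (L2dot_linearl 1 xgL uL phiL) mul1r.
  rewrite (L2dot_mul_fst _ u) (L2dot_mul_fst _ g.1).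
  have aux (A B C : R) : A + B = - C -> A + (C + B) = 0.
    by clear=> AB; rewrite addrCA AB subrr.
  exact: aux e.
have := H10_gradient_orthogonal xuL L2_0 hL orth ug.
rewrite L2dot0l addr0 (L2dot_linearl 1 xgL uL uL) mul1r.
have -> : L2dot Omega (fun x => x.1 * u x) g.1 =
    L2dot Omega (fun x => x.1 * g.1 x) u by rewrite L2dot_mul_fst L2dotC.
(* With XX, XU, UU the products of [x.1 * g.1] and [u], this reads [0 <= 4 XX + 4 XU + UU].
   Inserting [UU = - 2 XU] leaves [UU <= 4 XX], and XX is at most [M ^+ 2] times the square of
   [g.1]. *)
have := L2dot_ge0 Omega (fun x => 2 * (x.1 * g.1 x) + u x).
rewrite (L2dot_sqr_linear 2 xgL uL).
have := L2dot_mul_fst_le xM g1L.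
have : 0 <= M ^+ 2 * L2dot Omega g.2 g.2.
  by rewrite mulr_ge0 ?sqr_ge0 ?L2dot_ge0.
have aux (G1 G2 XX XU UU : R) : 0 <= M ^+ 2 * G2 -> XX <= M ^+ 2 * G1 ->
    0 <= 2 ^+ 2 * XX + 2 * 2 * XU + UU -> XU + (XU + UU) = 0 ->
    UU <= 4 * M ^+ 2 * (G1 + G2).
  by clear; lra.
exact: aux.
Qed.

(** * Boundedness of the domain *)

Lemma convex_hull_bounded {R : realType} {n} (p : 'I_n -> R * R) :
  exists M : R, forall x, convex_hull_of p x -> `|x.1| <= M.
Proof.
(* Nonnegative weights of sum 1 are each at most 1, so this crude sum is a bound. *)
exists (\sum_i `|(p i).1|) => x [t [t0 t1 ->]].
have -> : (\sum_i t i *: p i).1 = \sum_i t i * (p i).1.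
  by apply: (big_ind2 (fun (y : R * R) z => y.1 = z)) => // y z y' z' /= -> ->.
rewrite (le_trans (ler_norm_sum _ _ _))//; apply: ler_sum => i _.
rewrite normrM ger0_norm// ler_piMl// -t1 (bigD1 i)//= lerDl sumr_ge0//.
Qed.

Lemma domain_bounded {R : realType} {Omega : set (R * R)} :
  smooth_bounded_domain Omega \/ convex_polygon Omega ->
  exists M : R, forall x, Omega x -> `|x.1| <= M.
Proof.
move=> [[_ _ _ bO _]|[_ [n [p ->]]]].
  by have [M _ OM] := bounded_set_prod bO; exists M => x /OM[].
have [M pM] := convex_hull_bounded p; exists M => x.
by move/interior_subset/pM.
Qed.

(** * The dual norm and the inf-sup estimate *)

(** With N the dual norm and [q] almost maximal in its definition, [a = N / |q|_1] gives [a * q] the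
    norm N. The scalar stays apart from [q], so that only the norm of [q] itself occurs. *)
Lemma Hm1norm_almost_attained {R : realType} {Omega : set (R * R)}
    {xi : (R * R -> R) -> R} :
  H10 Omega !=set0 -> Hm1 Omega xi ->
  0 <= Hm1norm Omega xi /\
  exists2 q, H10 Omega q & exists a : R,
    a ^+ 2 * H1norm Omega q ^+ 2 <= Hm1norm Omega xi ^+ 2 /\
    3 / 4 * Hm1norm Omega xi ^+ 2 <= a * xi q.
Proof.
move=> [v vH] [xi_lin [B xiB]]; rewrite /Hm1norm.
set S := [set r | _].
(* If every element of [H10] vanishes a.e. on [Omega], the supremum is over the empty set and equals
   0 by convention; [a = 0] then works. *)
have [S0|/set0P[r0 Sr0]] := eqVneq S set0.
  rewrite S0 sup0; split => //; exists v => //; exists 0.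
  by rewrite expr0n mulr0 !mul0r.
have supS : has_sup S.
  split; first by exists r0.
  exists `|B| => r [u [uH _ ->]]; rewrite /pairing.
  (* Division by zero yields 0, which the bound [|B|] covers whatever the sign of [B]. *)
  have [->|u0] := eqVneq (H1norm Omega u) 0; first by rewrite invr0 mulr0.
  have up : 0 < H1norm Omega u by rewrite lt_neqAle eq_sym u0 H1norm_ge0.
  rewrite ler_pdivrMr// (le_trans (ler_norm _))// (le_trans (xiB _ uH))//.
  by rewrite ler_wpM2r ?H1norm_ge0// ler_norm.
have N0 : 0 <= sup S.
  have [u [uH u0 r0E]] := Sr0.
  have [xiu|xiu] := leP 0 (xi u).
    apply: (@le_trans _ _ r0); last exact: ub_le_sup supS.2 _ Sr0.
    by rewrite r0E divr_ge0 ?H1norm_ge0.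
  (* This is [- u] in the shape [a * u + v]; it turns a negative quotient into a nonnegative one. *)
  pose u' := fun x => -2 * u x + u x.
  have uE x : u' x = - u x by rewrite /u'; lra.
  have Su' : S (pairing u' xi / H1norm Omega u').
    exists u'; split; [exact: H10_linear| |by []].
    have u'u : [set x | Omega x -> u' x = 0] = [set x | Omega x -> u x = 0].
      apply/funext => x; rewrite /mkset uE.
      apply/propext; split => + Ox => /(_ Ox).
        by move/eqP; rewrite oppr_eq0 => /eqP.
      by move=> ->; rewrite oppr0.
    apply: contra_not u0 => u'0.
    have : almost_everywhere leb2 [set x | Omega x -> u' x = 0] := u'0.
    by rewrite u'u.
  apply: (le_trans _ (ub_le_sup supS.2 Su')).
  rewrite divr_ge0 ?H1norm_ge0// /pairing xi_lin//; lra.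
split=> //.
have [->|N1] := eqVneq (sup S) 0.
  by exists v => //; exists 0; rewrite !expr0n mulr0 !mul0r.
have Np : 0 < sup S by rewrite lt_neqAle eq_sym N1.
have Np4 : 0 < sup S / 4 by rewrite divr_gt0.
(* Missing the supremum by less than a quarter of it gives the factor 3/4, which leaves N^2/4 after
   Young's inequality takes N^2/2. *)
have [r [q [qH _ rE]] rN] := sup_adherent Np4 supS.
have rp : 3 / 4 * sup S < r by move: rN; lra.
have q0 : H1norm Omega q != 0.
  by apply: contraTneq rp => q0; rewrite rE q0 invr0 mulr0 -leNgt mulr_ge0.
exists q => //; exists (sup S / H1norm Omega q).
split; first by rewrite -exprMn divfK.
have -> : sup S / H1norm Omega q * xi q = sup S * r.
  by rewrite rE /pairing mulrAC mulrA.
by rewrite [leRHS]mulrC expr2 mulrA ler_wpM2r// ltW.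
Qed.

Theorem theorem2p1 (R : realType) (Omega : set (R * R))
    (hOmega : smooth_bounded_domain Omega \/ convex_polygon Omega) :
  exists c C : R, [/\ 0 < c, 0 < C &
    forall (v : R * R -> R) (xi : (R * R -> R) -> R),
      H10 Omega v -> Hm1 Omega xi ->
      exists2 w : R * R -> R, H10 Omega w &
        bilinB Omega v xi w (fun u => - xi u)
          >= c * (H1norm Omega v + Hm1norm Omega xi) ^+ 2 /\
        H1norm Omega w <= C * (H1norm Omega v + Hm1norm Omega xi)].
Proof.
have [M OM] := domain_bounded hOmega.
pose K := 1 + 4 * M ^+ 2.
have K1 : 1 <= K by rewrite lerDl mulr_ge0 ?sqr_ge0.
have K0 : 0 < K by exact: lt_le_trans K1.
(* Poincare gives [|v|_1^2 <= K |grad v|^2], so [(|v|_1 + N)^2 <= 2 K (|grad v|^2 + N^2)], whereas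
   the form is at least a quarter of [|grad v|^2 + N^2]; hence 8 K. The constant 2 comes from
   [|w|_1^2 <= 2 N^2 + 2 |v|_1^2]. *)
exists (8 * K)^-1, 2; split; [by rewrite invr_gt0 mulr_gt0|by []|].
move=> v xi vH xiH.
have [N0 [q qH [a [aq axiq]]]] :=
  Hm1norm_almost_attained (ex_intro _ v vH) xiH.
have wH := H10_linear (- a) qH vH.
exists (fun x => - a * q x + v x) => //.
have n0 := H1norm_ge0 Omega v.
split; last first.
  rewrite -ler_sqr ?nnegrE ?H1norm_ge0 ?mulr_ge0 ?addr_ge0//.
  apply: (le_trans (sqr_H1norm_linear_le (- a) qH vH)); rewrite sqrrN.
  have aux (n N A : R) : 0 <= n -> 0 <= N -> A <= N ^+ 2 ->
      2 * A + 2 * n ^+ 2 <= (2 * (n + N)) ^+ 2.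
    by clear; nra.
  by rewrite -mulrA; exact: aux.
have [_ v1L v2L] := grad_L2 vH.
rewrite /bilinB /pairing (L2dot2_grad_linear (- a) v1L v2L qH vH).
rewrite (xiH.1 (- a) q v qH vH).
have qG : L2dot2 Omega (grad Omega q) (grad Omega q) <= H1norm Omega q ^+ 2.
  by rewrite sqr_H1norm lerDl L2dot_ge0.
have vG : H1norm Omega v ^+ 2
    <= K * L2dot2 Omega (grad Omega v) (grad Omega v).
  by rewrite sqr_H1norm /K mulrDl mul1r lerD2l; exact: poincare.
(* Expanded, the nonnegativity of [|grad (v - a * q)|^2] is Young's inequality for the cross
   term. *)
have young := L2dot2_ge0 Omega (grad Omega (fun x => - a * q x + v x)).
have wE := L2dot2_grad_sqr_linear (- a) qH vH.
have aux (n N GG GQ QG QQ q2 X Y WW : R) : n ^+ 2 <= K * GG -> QQ <= q2 ->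
    a ^+ 2 * q2 <= N ^+ 2 -> 3 / 4 * N ^+ 2 <= a * X ->
    0 <= WW -> WW = (- a) ^+ 2 * QQ + 2 * - a * QG + GG -> QG = GQ ->
    (8 * K)^-1 * (n + N) ^+ 2 <= - a * GQ + GG - (- a * X + Y) - - Y.
  clear -K0 K1 => nG Qq aqN aX + WE QGE.
  rewrite {WW}WE {QG}QGE sqrrN => yo.
  have aQ : a ^+ 2 * QQ <= N ^+ 2.
    by rewrite (le_trans _ aqN)// ler_wpM2l ?sqr_ge0.
  have nN : (n + N) ^+ 2 <= 2 * K * GG + 2 * K * N ^+ 2.
    have : N ^+ 2 <= K * N ^+ 2 by rewrite ler_peMl ?sqr_ge0.
    have := sqr_ge0 (n - N); lra.
  have GG0 : 0 <= GG by rewrite -(pmulr_rge0 _ K0) (le_trans _ nG)// sqr_ge0.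
  (* The terms in [Y = xi v] cancel. Young's inequality bounds [a * GQ] by [(GG + N ^+ 2) / 2], and
     [a * X] contributes at least [3 / 4 * N ^+ 2]. *)
  have lower : (GG + N ^+ 2) / 4 <= - a * GQ + GG - (- a * X + Y) - - Y.
    by have := sqr_ge0 N; lra.
  have K8 : 0 < 8 * K by rewrite mulr_gt0.
  rewrite mulrC ler_pdivrMr// mulrC.
  apply: le_trans (ler_wpM2l (ltW K8) lower); lra.
exact: aux vG qG aq axiq young wE (L2dot2C _ _ _).
Qed.
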